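(* Let $n \ge 1$, let $f:\mathbb{R}^n\to\mathbb{R}^n$ be a super-linearizable polynomial vector field, and let $\phi:\mathbb{R}^n\to\mathbb{R}^n$ be a tame automorphism. Then the polynomial vector field $h(y) = D\phi_{\phi^{-1}(y)}\, f(\phi^{-1}(y))$, obtained from $\dot x = f(x)$ by the change of variables $y=\phi(x)$, is super-linearizable.
   Context: For a vector field $f$ on $\mathbb{R}^n$, $e^{tf}x_0$ denotes the value at time $t$ of the solution of $\dot x = f(x)$, $x(0)=x_0$. For $m\ge n$, $\Pi_n:\mathbb{R}^m\to\mathbb{R}^n$ is the projection on the first $n$ coordinates. $D\phi_x$ is the Jacobian matrix of $\phi$ at $x$. Super-linearizable: a polynomial vector field $f:\mathbb{R}^n\to\mathbb{R}^n$ is super-linearizable if there exist $k$, a polynomial map $p:\mathbb{R}^n\to\mathbb{R}^k$ and a matrix $A\in\mathbb{R}^{(n+k)\times(n+k)}$ such that for all $x_0\in\mathbb{R}^n$ and all $t\ge 0$, $\Pi_n(e^{At}z_0)=e^{tf}x_0$, where $z_0=(x_0,p(x_0))$ (in particular solutions of $\dot x=f(x)$ exist for all $t\ge 0$). A polynomial automorphism of $\mathbb{R}^n$ is a polynomial bijection $\mathbb{R}^n\to\mathbb{R}^n$ with polynomial inverse. An affine transformation is a map $x\mapsto Ax+b$ with $A\in\mathbb{R}^{n\times n}$ invertible and $b\in\mathbb{R}^n$. An elementary transformation is a map $x\mapsto (x_1,\ldots,x_{n-1},x_n+g(x_1,\ldots,x_{n-1}))$ with $g$ a real polynomial of degree greater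 than 1. A tame automorphism is a finite composition of affine and elementary transformations. *)

(* Defs.v *)
From HB Require Import structures.
From mathcomp Require Import all_boot all_order all_algebra.
From mathcomp Require Import all_classical all_reals all_analysis.
(* The notations of mpoly clash with those of MathComp-Analysis. *)
From mathcomp.multinomials Require Import -(notations) mpoly.
Set Implicit Arguments.
Unset Strict Implicit.
Unset Printing Implicit Defensive.
Import Order.TTheory GRing.Theory Num.Theory.
Import numFieldNormedType.Exports.
Local Open Scope classical_set_scope.
Local Open Scope ring_scope.

(* Vectors of R^n are row vectors, as required by the library Jacobian 'J:
   matrices act on the right ([e^{At} z0] reads [z0 *m expmx (t *: A)]), and
   ['J phi x] is the transpose of D phi_x (D phi_x v reads [v *m 'J phi x]). *)

Definition polynomial_map (R : realType) (n m : nat)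
    (f : 'rV[R]_n -> 'rV[R]_m) : Prop :=
  exists P : 'I_m -> mpoly n R,
    forall x, f x = \row_i meval (fun j => x 0 j) (P i).

(* The derivative at [t] is relative to [0, +oo[, hence two-sided for [0 < t]
   and one-sided for [t = 0]. *)
Definition is_solution (R : realType) (n : nat) (f : 'rV[R]_n -> 'rV[R]_n)
    (x0 : 'rV[R]_n) (x : R -> 'rV[R]_n) : Prop :=
  x 0 = x0 /\
  forall t : R, 0 <= t ->
    (fun s : R => (s - t)^-1 *: (x s - x t))
      @ within [set s : R | 0 <= s] t^' --> f (x t).

Definition expmx (R : realType) (n : nat) (A : 'M[R]_n) : 'M[R]_n :=
  limn (series (fun i : nat => (i`!%:R)^-1 *: A ^+ i)).

Definition super_linearizable (R : realType) (n : nat)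
    (f : 'rV[R]_n -> 'rV[R]_n) : Prop :=
  polynomial_map f /\
  exists (k : nat) (p : 'rV[R]_n -> 'rV[R]_k) (A : 'M[R]_(n + k)),
    polynomial_map p /\
    forall x0 : 'rV[R]_n,
      exists x : R -> 'rV[R]_n,
        is_solution f x0 x /\
        forall t : R, 0 <= t ->
          lsubmx (row_mx x0 (p x0) *m expmx (t *: A)) = x t.

Definition affine_transformation (R : realType) (n : nat)
    (phi : 'rV[R]_n -> 'rV[R]_n) : Prop :=
  exists (A : 'M[R]_n) (b : 'rV[R]_n),
    A \in unitmx /\ forall x, phi x = x *m A + b.

(* [mpoly.msize g] is one more than the total degree of [g]. *)
Definition elementary_transformation (R : realType) (n : nat)
    (phi : 'rV[R]_n -> 'rV[R]_n) : Prop :=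
  exists g : mpoly n.-1 R,
    (2 < mpoly.msize g)%N /\
    forall x, phi x =
      \row_i (if i.+1 == n
              then x 0 i +
                   meval (fun j => x 0 (widen_ord (leq_pred n) j)) g
              else x 0 i).

(* The empty composition is the identity, which is affine. *)
Inductive tame_automorphism (R : realType) (n : nat) :
    ('rV[R]_n -> 'rV[R]_n) -> Prop :=
| tame_affine phi :
    affine_transformation phi -> tame_automorphism phi
| tame_elementary phi :
    elementary_transformation phi -> tame_automorphism phi
| tame_comp phi psi :
    tame_automorphism phi -> tame_automorphism psi ->
    tame_automorphism (phi \o psi).

(* [phi_inv] stands for the inverse of [phi]. *)
Definition change_of_variables (R : realType) (n : nat)
    (phi phi_inv f : 'rV[R]_n -> 'rV[R]_n) : 'rV[R]_n -> 'rV[R]_n :=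
  fun y => f (phi_inv y) *m 'J phi (phi_inv y).

Lemma tame_automorphism_bijective (R : realType) (n : nat)
    (phi : 'rV[R]_n -> 'rV[R]_n) : tame_automorphism phi -> bijective phi.
Proof.
elim=> {phi} [phi [A [b [uA phiE]]]|phi [g [_ phiE]]|phi psi _ bphi _ bpsi].
- exists (fun y => (y - b) *m invmx A) => x; rewrite phiE.
    by rewrite addrK mulmxK.
  by rewrite mulmxKV // subrK.
- pose e (c : R) (x : 'rV[R]_n) : 'rV[R]_n := \row_i (if i.+1 == n
    then x 0 i + c * meval
           (fun j => x 0 (widen_ord (leq_pred n) j)) g
    else x 0 i).
  have eK c d : c + d = 0 -> cancel (e c) (e d).
    move=> cd0 x.
    have ecx : (fun j => e c x 0 (widen_ord (leq_pred n) j)) =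
               (fun j => x 0 (widen_ord (leq_pred n) j)).
      apply/funext => j; rewrite !mxE /=.
      have : (j.+1 < n)%N by rewrite -ltn_predRL.
      by rewrite ltn_neqAle => /andP[/negPf ->].
    apply/rowP => i; rewrite !mxE; case: ifP => iE; rewrite iE //.
    by rewrite ecx -addrA -mulrDl cd0 mul0r addr0.
  have e1E : e 1 =1 phi.
    by move=> x; rewrite phiE; apply/rowP => i; rewrite !mxE mul1r.
  have e1_bij : bijective (e 1).
    by exists (e (-1)); apply: eK; rewrite ?subrr ?addNr.
  exact: (eq_bij e1_bij).
- exact: bij_comp.
Qed.

(* Main.v *)
(* Along the trajectory z(t) = z0 e^{At} of the lifted system, any polynomial in
   the coordinates of z(t) lies in a finite-dimensional space of functions of
   (x0, t) closed under d/dt and with initial values polynomial in x0, because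
   such functions are stable under sums (direct sum of systems) and products
   (tensor product of systems).  This applies to the coordinates of
   y(t) = phi(x(t)): if w' = w B and y = w C, then (y, w) solves the linear
   system (y, w)' = (w B C, w B), and its initial value
   (y0, w(phi^-1(y0), 0)) is polynomial in y0.  Tameness is only used to know
   that phi and its inverse are polynomial. *)
Require Import Defs.
From mathcomp Require Import all_boot all_order all_algebra.
From mathcomp Require Import all_classical all_reals all_analysis.
From mathcomp.multinomials Require Import -(notations) mpoly.
Import Order.TTheory GRing.Theory Num.Theory.
Import numFieldNormedType.Exports.
Local Open Scope classical_set_scope.
Local Open Scope ring_scope.
Set Implicit Arguments.
Unset Strict Implicit.
Unset Printing Implicit Defensive.

(** * Entrywise convergence and calculus of the matrix exponential *)

Lemma cvg_mx (R : realType) (m n : nat) (T : Type) (F : set_system T)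
    {FF : Filter F} (f : T -> 'M[R]_(m, n)) (L : 'M[R]_(m, n)) :
  (forall i j, (fun x => f x i j) @ F --> L i j) -> f @ F --> L.
Proof.
move=> fL A [P LP PA].
apply: (@filterS _ F FF [set x | forall i j, P i j (f x i j)]) => [x|].
  exact: PA.
by apply: filter_forall => i; apply: filter_forall => j; exact/fL/LP.
Qed.

(** The geometric bound makes the exponential series of [M * |x|], scaled by [C], a majorant. *)
Lemma is_cvg_pseries_fact (R : realType) (a : nat -> R) (C M : R) (x : R) :
  (forall k, `|a k| <= C * M ^+ k) ->
  cvgn (pseries (fun k => a k / k`!%:R) x).
Proof.
move=> aM; apply: normed_cvg.
apply: (@series_le_cvg _ _ (fun k => C * exp_coeff (M * `|x|) k)) => [k|k|k|].
- exact: normr_ge0.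
- rewrite /exp_coeff /= exprMn !mulrA; apply: divr_ge0 => //.
  apply: mulr_ge0 => //; exact: le_trans (aM k).
- rewrite /exp_coeff /= !normrM normfV normr_nat normrX exprMn mulrAC !mulrA.
  by rewrite ler_wpM2r ?invr_ge0 ?ler0n// ler_wpM2r ?exprn_ge0.
- exact/is_cvg_seriesZ/is_cvg_series_exp_coeff.
Qed.

(** Differentiating an exponential generating series termwise shifts its coefficients. A shift keeps
    a geometric bound, with [C * M] in place of [C], so the series and its first two formal
    derivatives converge at [|x| + 1], beyond [x]. *)
Lemma is_derive_pseries_fact (R : realType) (a : nat -> R) (C M : R) (x : R) :
  (forall k, `|a k| <= C * M ^+ k) ->
  is_derive x 1 (fun t => limn (pseries (fun k => a k / k`!%:R) t))
    (limn (pseries (fun k => a k.+1 / k`!%:R) x)).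
Proof.
have diffsE (b : nat -> R) :
    pseries_diffs (fun k => b k / k`!%:R) = (fun k => b k.+1 / k`!%:R).
  apply/funext => k; rewrite /pseries_diffs factS natrM invfM.
  by rewrite mulrCA mulVKf.
move=> aM.
have shiftM (b : nat -> R) D : (forall k, `|b k| <= D * M ^+ k) ->
    forall k, `|b k.+1| <= (D * M) * M ^+ k.
  by move=> bM k; rewrite -mulrA -exprS.
rewrite -diffsE; apply: (@pseries_snd_diffs _ _ (`|x| + 1)).
- exact: is_cvg_pseries_fact aM.
- by rewrite diffsE; apply: is_cvg_pseries_fact (shiftM _ _ aM).
- rewrite !diffsE.
  exact: is_cvg_pseries_fact (shiftM _ _ (shiftM _ _ aM)).
- by rewrite [ltRHS]ger0_norm ?ltrDl// addr_ge0.
Qed.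

(** The sum of all [|A r s|] dominates each row sum of absolute values, so each further factor [A]
    costs at most one factor of it. *)
Lemma mxpow_entry_bound (R : realType) (n : nat) (A : 'M[R]_n) k i j :
  `|(A ^+ k) i j| <= 1 * (\sum_r \sum_s `|A r s|) ^+ k.
Proof.
rewrite mul1r; elim: k i j => [|k IH] i j.
  by rewrite !expr0 mxE; case: eqP; rewrite ?normr1 ?normr0.
rewrite !exprS mxE (le_trans (ler_norm_sum _ _ _))//.
apply: (@le_trans _ _
  (\sum_s `|A i s| * (\sum_r \sum_s `|A r s|) ^+ k)).
  by apply: ler_sum => s _; rewrite normrM ler_wpM2l.
rewrite -mulr_suml ler_wpM2r ?exprn_ge0 ?sumr_ge0// => [r _|].
  by rewrite sumr_ge0.
rewrite [leRHS](bigD1 i)//= lerDl sumr_ge0// => r _.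
by rewrite sumr_ge0.
Qed.

(** Reduces calculus on [expmx] to scalar power series in [t]: matrices converge entrywise, and [t]
    factors out of the powers of [t *: A]. *)
Lemma expmx_entryE (R : realType) (n : nat) (A : 'M[R]_n) (t : R) i j :
  expmx (t *: A) i j = limn (pseries (fun k => (A ^+ k) i j / k`!%:R) t).
Proof.
have exprZ k : (t *: A) ^+ k = t ^+ k *: A ^+ k.
  elim: k => [|k IH]; first by rewrite !expr0 scale1r.
  by rewrite !exprS IH -[LHS]scalemxAl -[X in _ *: X]scalemxAr scalerA.
pose L : 'M[R]_n :=
  \matrix_(i, j) limn (pseries (fun k => (A ^+ k) i j / k`!%:R) t).
suff -> : expmx (t *: A) = L by rewrite mxE.
apply/cvg_lim => //; apply: cvg_mx => r s; rewrite mxE.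
have /cvg_ex[l cl] : cvgn (pseries (fun k => (A ^+ k) r s / k`!%:R) t).
  exact: is_cvg_pseries_fact (fun k => mxpow_entry_bound A k r s).
rewrite (cvg_lim _ cl)//; apply: cvg_trans cl; apply: near_eq_cvg.
apply: nearW => N /=; rewrite /pseries /series /= summxE.
apply: eq_bigr => k _; rewrite exprZ !mxE [RHS]mulrCA [LHS]mulrC.
by congr (_ * _); exact: mulrC.
Qed.

Lemma expmx0 (R : realType) (n : nat) : expmx (0 : 'M[R]_n) = 1%:M.
Proof.
apply/matrixP => i j; rewrite -(scale0r (1%:M : 'M[R]_n)) expmx_entryE.
(* The empty partial sum is 0, so the sequence is constant only from index 1 on; hence the shift.
   The surviving term is k = 0, where 0 ^+ 0 = 1. *)
apply/cvg_lim => //; rewrite -cvg_shiftS /=; apply: cvg_near_cst.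
apply: nearW => N; rewrite /pseries /series /= big_nat_recl//= !expr0.
rewrite big1_seq ?addr0 ?fact0 ?invr1 ?mulr1//.
by move=> k _; rewrite expr0n mulr0.
Qed.

(** The shifted coefficient [A ^+ k.+1] factors on either side. The left form enters the uniqueness
    argument for linear systems, the right form the derivative of [z *m expmx (t *: A)]. *)
Lemma is_derive_expmx (R : realType) (n : nat) (A : 'M[R]_n) (t : R) i j :
  is_derive t 1 (fun s => expmx (s *: A) i j) ((A *m expmx (t *: A)) i j) /\
  is_derive t 1 (fun s => expmx (s *: A) i j) ((expmx (t *: A) *m A) i j).
Proof.
have der : is_derive t 1 (fun s => expmx (s *: A) i j)
    (limn (pseries (fun k => (A ^+ k.+1) i j / k`!%:R) t)).
  under eq_fun do rewrite expmx_entryE.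
  exact: is_derive_pseries_fact (fun k => mxpow_entry_bound A k i j).
have cv r s : pseries (fun k => (A ^+ k) r s / k`!%:R) t @ \oo -->
    expmx (t *: A) r s.
  rewrite expmx_entryE.
  exact: is_cvg_pseries_fact (fun k => mxpow_entry_bound A k r s).
have cvg_comb (c : 'I_n -> R) (u : 'I_n -> nat -> R) (l : 'I_n -> R) :
    (forall r, u r @ \oo --> l r) ->
    (fun N => \sum_r c r * u r N) @ \oo --> \sum_r c r * l r.
  move=> ul; apply: cvg_big => [|r _]; first exact: add_continuous.
  by apply: cvgM => //; exact: cvg_cst.
split; apply: is_derive_eq der _; apply/cvg_lim => //; rewrite mxE.
- apply: cvg_trans (cvg_comb (A i) _ _ (cv^~ j)).
  apply: near_eq_cvg; apply: nearW => N; rewrite /pseries /series /=.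
  under eq_bigr do rewrite mulr_sumr.
  rewrite exchange_big; apply: eq_bigr => k _ /=.
  rewrite exprS mxE 2!mulr_suml; apply: eq_bigr => r _.
  by rewrite !mulrA.
- under eq_bigr do rewrite mulrC.
  apply: cvg_trans (cvg_comb (A^~ j) _ _ (cv i)).
  apply: near_eq_cvg; apply: nearW => N; rewrite /pseries /series /=.
  under eq_bigr do rewrite mulr_sumr.
  rewrite exchange_big; apply: eq_bigr => k _ /=.
  rewrite exprSr mxE 2!mulr_suml; apply: eq_bigr => r _.
  by rewrite [LHS]mulrC [LHS]mulrAC [in LHS](mulrAC _ _ (A r j)).
Qed.

(** * Polynomial functions, their derivatives and compositions *)

Definition polynomial_fun (R : realType) (n : nat) (u : 'rV[R]_n -> R) :=
  exists P : mpoly n R, forall x, u x = meval (fun j => x 0 j) P.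

Section PolynomialFun.
Variables (R : realType) (n : nat).
Implicit Types u v : 'rV[R]_n -> R.

Lemma polynomial_mapP m (f : 'rV[R]_n -> 'rV[R]_m) :
  polynomial_map f <-> forall i, polynomial_fun (fun x => f x 0 i).
Proof.
split=> [[P fP] i|]; first by exists (P i) => x; rewrite fP mxE.
by move=> /choice[P fP]; exists P => x; apply/rowP => i; rewrite mxE.
Qed.

Lemma polynomial_fun_cst c : polynomial_fun (fun _ : 'rV[R]_n => c).
Proof. by exists (mpolyC n c) => x; rewrite mevalC. Qed.

Lemma polynomial_fun_coord i : polynomial_fun (fun x : 'rV[R]_n => x 0 i).
Proof. by exists (mpolyX R (mnm1 i)) => x; rewrite mevalXU. Qed.

Lemma polynomial_funD u v : polynomial_fun u -> polynomial_fun v ->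
  polynomial_fun (fun x => u x + v x).
Proof. by move=> [P uP] [Q vQ]; exists (P + Q) => x; rewrite mevalD uP vQ. Qed.

Lemma polynomial_funM u v : polynomial_fun u -> polynomial_fun v ->
  polynomial_fun (fun x => u x * v x).
Proof. by move=> [P uP] [Q vQ]; exists (P * Q) => x; rewrite mevalM uP vQ. Qed.

Lemma polynomial_fun_sum (I : finType) (u : I -> 'rV[R]_n -> R) :
  (forall i, polynomial_fun (u i)) -> polynomial_fun (fun x => \sum_i u i x).
Proof.
move=> /choice[P uP]; exists (\sum_i P i) => x.
by rewrite raddf_sum; apply: eq_bigr => i _; rewrite uP.
Qed.

(** Lets differentiability, composition and linear generation be proved from closure under sums and
    products, without handling monomials. *)
Lemma polynomial_fun_ind (Q : ('rV[R]_n -> R) -> Prop) :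
  (forall c, Q (fun _ => c)) -> (forall i, Q (fun x => x 0 i)) ->
  (forall u v, Q u -> Q v -> Q (fun x => u x + v x)) ->
  (forall u v, Q u -> Q v -> Q (fun x => u x * v x)) ->
  forall u, polynomial_fun u -> Q u.
Proof.
move=> Qcst Qcoord QD QM u [P uP].
rewrite (_ : u = fun x => meval (fun j => x 0 j) P); last exact/funext.
under eq_fun do rewrite mevalE.
(* Three nested inductions: on the monomials of the support, on the variables of a monomial, on the
   exponent of a variable. *)
elim: (msupp P : seq _) => [|m s IH].
  by under eq_fun do rewrite big_nil.
under eq_fun do rewrite big_cons.
apply: (QD) IH; apply: (QM); first exact: Qcst.
elim: (index_enum _) => [|i r IH].
  by under eq_fun do rewrite big_nil.
under eq_fun do rewrite big_cons.
apply: (QM) IH; elim: (m i) => [|k IH].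
  by under eq_fun do rewrite expr0.
by under eq_fun do rewrite exprS; apply: (QM).
Qed.

Lemma polynomial_fun_differentiable u x :
  polynomial_fun u -> differentiable u x.
Proof.
elim/polynomial_fun_ind: u / => [c|i|u v du dv|u v du dv].
- exact: differentiable_cst.
- exact: differentiable_coord.
- exact: differentiableD.
- exact: differentiableM.
Qed.

Lemma polynomial_fun_derive u w :
  polynomial_fun u -> polynomial_fun (fun x => 'D_w u x).
Proof.
move=> pu.
(* The Leibniz rule involves the factors themselves, so the induction carries both properties. *)
suff [] : polynomial_fun u /\ polynomial_fun (fun x => 'D_w u x) by [].
elim/polynomial_fun_ind: u / pu
  => [c|i|u v [pu du] [pv dv]|u v [pu du] [pv dv]].
- split; first exact: polynomial_fun_cst.
  by under eq_fun do rewrite derive_cst; exact: polynomial_fun_cst.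
- split; first exact: polynomial_fun_coord.
  rewrite (_ : (fun x => _) = fun=> w 0 i); first exact: polynomial_fun_cst.
  apply/funext => x; have /matrixP/(_ 0 i) := derive_mx (@derivable_id R _ x w).
  by rewrite derive_id mxE.
- split; first exact: polynomial_funD.
  rewrite (_ : (fun x => _) = fun x => 'D_w u x + 'D_w v x).
    exact: polynomial_funD.
  apply/funext => x; apply: deriveD; apply: diff_derivable;
  exact: polynomial_fun_differentiable.
- split; first exact: polynomial_funM.
  rewrite (_ : (fun x => _) = fun x => u x * 'D_w v x + v x * 'D_w u x).
    by apply: polynomial_funD; apply: polynomial_funM.
  apply/funext => x; apply: deriveM; apply: diff_derivable;
  exact: polynomial_fun_differentiable.
Qed.

End PolynomialFun.

Lemma polynomial_fun_comp (R : realType) (m n : nat)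
    (f : 'rV[R]_m -> 'rV[R]_n) (u : 'rV[R]_n -> R) :
  polynomial_fun u -> polynomial_map f -> polynomial_fun (fun x => u (f x)).
Proof.
move=> + /polynomial_mapP pf; elim/polynomial_fun_ind: u / => //.
- by move=> c; exact: polynomial_fun_cst.
- by move=> v w; exact: polynomial_funD.
- by move=> v w; exact: polynomial_funM.
Qed.

Lemma polynomial_map_differentiable (R : realType) (m n : nat)
    (f : 'rV[R]_m -> 'rV[R]_n) x : polynomial_map f -> differentiable f x.
Proof.
move=> /polynomial_mapP pf.
rewrite (_ : f = \sum_i (fun y => f y 0 i *: delta_mx 0 i)); last first.
  by apply/funext => y; rewrite fct_sumE; exact: row_sum_delta.
apply: differentiable_sum => i; apply: differentiableZl.
exact: polynomial_fun_differentiable.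
Qed.

Lemma polynomial_fun_jacobian (R : realType) (m n : nat)
    (f : 'rV[R]_m -> 'rV[R]_n) i j :
  polynomial_map f -> polynomial_fun (fun x => 'J f x i j).
Proof.
move=> pf; have df x : differentiable f x := polynomial_map_differentiable x pf.
rewrite (_ : (fun x => _) = fun x => 'D_(delta_mx 0 i) (fun y => f y 0 j) x).
  by apply: polynomial_fun_derive; exact: (polynomial_mapP f).1.
apply/funext => x; have /matrixP/(_ 0 j) :=
  derive_mx (diff_derivable (df x) : derivable f x (delta_mx 0 i)).
by rewrite deriveEjacobian// -rowE !mxE.
Qed.

Lemma polynomial_map_comp (R : realType) (m n p : nat)
    (f : 'rV[R]_m -> 'rV[R]_n) (g : 'rV[R]_n -> 'rV[R]_p) :
  polynomial_map g -> polynomial_map f -> polynomial_map (g \o f).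
Proof.
move=> /polynomial_mapP pg pf; apply/polynomial_mapP => i.
exact: (polynomial_fun_comp (pg i)).
Qed.

(** * Tame automorphisms and their inverses are polynomial *)

Lemma affine_polynomial (R : realType) (n : nat) (A : 'M[R]_n) (b : 'rV[R]_n) :
  polynomial_map (fun x => x *m A + b).
Proof.
apply/polynomial_mapP => i; under eq_fun do rewrite 2!mxE.
apply: polynomial_funD; last exact: polynomial_fun_cst.
apply: polynomial_fun_sum => j; apply: polynomial_funM.
  exact: polynomial_fun_coord.
exact: polynomial_fun_cst.
Qed.

(** The factor [c] covers an elementary transformation ([c = 1]) and its inverse ([c = -1]) at
    once. *)
Lemma shear_polynomial (R : realType) (n : nat) (c : R) (g : mpoly n.-1 R) :
  polynomial_map (fun x : 'rV[R]_n => \row_i (if i.+1 == n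
    then x 0 i + c * meval (fun j => x 0 (widen_ord (leq_pred n) j)) g
    else x 0 i)).
Proof.
apply/polynomial_mapP => i; under eq_fun do rewrite mxE.
case: (i.+1 == n) ; last exact: polynomial_fun_coord.
apply: polynomial_funD; first exact: polynomial_fun_coord.
apply: polynomial_funM; first exact: polynomial_fun_cst.
pose r (x : 'rV[R]_n) := \row_j x 0 (widen_ord (leq_pred n) j).
have gr (x : 'rV[R]_n) : meval (fun j => x 0 (widen_ord (leq_pred n) j)) g =
    meval (fun j => r x 0 j) g by apply: meval_eq => j; rewrite mxE.
under eq_fun do rewrite gr.
apply: (@polynomial_fun_comp _ _ _ r (fun y => meval (fun j => y 0 j) g)).
  by exists g.
apply/polynomial_mapP => j; under eq_fun do rewrite mxE.
exact: polynomial_fun_coord.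
Qed.

Lemma tame_automorphism_polynomial (R : realType) (n : nat)
    (phi : 'rV[R]_n -> 'rV[R]_n) : tame_automorphism phi ->
  polynomial_map phi /\
  exists2 psi, polynomial_map psi & cancel psi phi.
Proof.
elim=> {phi} [phi [A [b [uA phiE]]]|phi [g [_ phiE]]
  |phi psi _ [pphi [phi' pphi' phiK]] _ [ppsi [psi' ppsi' psiK]]].
- split.
    rewrite (_ : phi = fun x => x *m A + b); last exact/funext.
    exact: affine_polynomial.
  exists (fun y => y *m invmx A + - b *m invmx A).
    exact: affine_polynomial.
  by move=> x; rewrite phiE -mulmxDl mulmxKV// subrK.
- pose e (c : R) (x : 'rV[R]_n) : 'rV[R]_n := \row_i (if i.+1 == n
    then x 0 i + c * meval (fun j => x 0 (widen_ord (leq_pred n) j)) g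
    else x 0 i).
  have phi_e : phi = e 1.
    apply/funext => x; rewrite phiE.
    by apply/rowP => i; rewrite !mxE mul1r.
  split; first by rewrite phi_e; exact: shear_polynomial.
  exists (e (-1)); first exact: shear_polynomial.
  move=> x; rewrite phi_e; apply/rowP => i.
  (* A shear fixes the first n-1 coordinates, so [g] takes the same value before and after it. *)
  have ex : meval (fun j => e (-1) x 0 (widen_ord (leq_pred n) j)) g =
      meval (fun j => x 0 (widen_ord (leq_pred n) j)) g.
    apply: meval_eq => j; rewrite mxE /= ltn_eqF//.
    by rewrite -ltn_predRL ltn_ord.
  rewrite [LHS]mxE ex mxE; case: (i.+1 == n) => //.
  by rewrite mul1r mulN1r subrK.
- split; first exact: polynomial_map_comp.
  exists (psi' \o phi'); first exact: polynomial_map_comp.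
  by move=> x; rewrite /= psiK phiK.
Qed.

(** * Uniqueness for linear differential systems *)

Lemma is_derive_lincomb (R : realType) (I : finType) (c : I -> R)
    (u : I -> R -> R) (du : I -> R) (t : R) :
  (forall i, is_derive t 1 (u i) (du i)) ->
  is_derive t 1 (fun s => \sum_i c i * u i s) (\sum_i c i * du i).
Proof.
move=> dudu.
have -> : (fun s => \sum_i c i * u i s) = \sum_i (c i \*: u i).
  by apply/funext => s; rewrite fct_sumE.
elim/big_ind2: _ => [|f df g dg Hf Hg|i _].
- exact: is_derive_cst.
- exact: is_deriveD.
- exact: is_deriveZ.
Qed.

Lemma is_derive_prod (R : realType) (u v : R -> R) (du dv t : R) :
  is_derive t 1 u du -> is_derive t 1 v dv ->
  is_derive t 1 (fun s => u s * v s) (du * v t + u t * dv).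
Proof.
move=> hu hv; apply: is_derive_eq (is_deriveM hu hv) _.
by rewrite addrC; congr (_ + _); rewrite mulrC.
Qed.

Lemma linear_ode_unique (R : realType) (n : nat) (A : 'M[R]_n)
    (w : R -> 'rV[R]_n) :
  (forall (t : R) i, is_derive t 1 (fun s => w s 0 i) ((w t *m A) 0 i)) ->
  forall t, w t = w 0 *m expmx (t *: A).
Proof.
move=> dw t; apply/rowP => i.
(* [w s *m e^{(t - s) A}] has zero derivative in [s]. *)
pose F s := (w s *m expmx ((t - s) *: A)) 0 i.
have -> : w t 0 i = F t by rewrite /F subrr scale0r expmx0 mulmx1.
have -> : (w 0 *m expmx (t *: A)) 0 i = F 0 by rewrite /F subr0.
apply: is_derive_0_is_cst => s.
have -> : F = \sum_j (fun r => w r 0 j * expmx ((t - r) *: A) j i).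
  by apply/funext => r; rewrite fct_sumE /F mxE.
have dE j : is_derive s 1 (fun r => expmx ((t - r) *: A) j i)
    (- (A *m expmx ((t - s) *: A)) j i).
  have dsub : is_derive s 1 (fun r => t - r) (- 1).
    apply: is_derive_eq (is_deriveB (is_derive_cst t s 1) (is_derive_id s 1)) _.
    exact: sub0r.
  rewrite -mulrN1.
  exact: (@is_derive1_comp R (fun r => expmx (r *: A) j i) (fun r => t - r) s
    _ _
    (is_derive_expmx A (t - s) j i).1 dsub).
apply: is_derive_eq (is_derive_sum (fun j => is_derive_prod (dw s j) (dE j))) _.
(* The two halves of the product rule are [(w A) e] and [w (A e)], which cancel by associativity. *)
under eq_bigr do rewrite mulrN.
apply/eqP; rewrite big_split sumrN subr_eq0; apply/eqP.
by have /rowP/(_ i) := mulmxA (w s) A (expmx ((t - s) *: A)); rewrite !mxE.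
Qed.

(** * Finite-dimensional spaces of functions closed under time derivative *)

(* The arguments of [u] and of the [w i] are an initial point and a time. *)
Definition in_span (R : realType) (T : Type) (I : finType)
    (w : I -> T -> R -> R) (u : T -> R -> R) :=
  exists c : I -> R, forall x t, u x t = \sum_i c i * w i x t.

(** The coefficients given by [in_span] do not depend on the initial point: a single constant matrix
    governs the family for all initial points. *)
Definition linear_system (R : realType) (n : nat) (I : finType)
    (w : I -> 'rV[R]_n -> R -> R) :=
  (forall i, polynomial_fun (fun x => w i x 0)) /\
  forall i, exists2 dw, in_span w dw &
    forall x (t : R), is_derive t 1 (w i x) (dw x t).

Definition linearly_generated (R : realType) (n : nat)
    (u : 'rV[R]_n -> R -> R) :=
  exists (I : finType) (w : I -> 'rV[R]_n -> R -> R),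
    linear_system w /\ in_span w u.

Section Span.
Variables (R : realType) (T : Type).
Implicit Types (I J : finType) (u v : T -> R -> R).

Lemma in_span_mem I (w : I -> T -> R -> R) i : in_span w (w i).
Proof.
exists (fun j => (i == j)%:R) => x t.
rewrite (bigD1 i)//= eqxx mul1r big1 ?addr0// => j ji.
by rewrite eq_sym (negbTE ji) mul0r.
Qed.

Lemma in_spanD I (w : I -> T -> R -> R) u v : in_span w u -> in_span w v ->
  in_span w (fun x t => u x t + v x t).
Proof.
move=> [c uc] [d vd]; exists (fun i => c i + d i) => x t.
by rewrite uc vd -big_split; apply: eq_bigr => i _; rewrite mulrDl.
Qed.

Lemma in_spanZ I (w : I -> T -> R -> R) a u : in_span w u ->
  in_span w (fun x t => a * u x t).
Proof.
move=> [c uc]; exists (fun i => a * c i) => x t.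
by rewrite uc mulr_sumr; apply: eq_bigr => i _; rewrite mulrA.
Qed.

Lemma in_span_sum I J (w : I -> T -> R -> R) (u : J -> T -> R -> R) :
  (forall j, in_span w (u j)) -> in_span w (fun x t => \sum_j u j x t).
Proof.
move=> /choice[c uc]; exists (fun i => \sum_j c j i) => x t.
under [RHS]eq_bigr do rewrite mulr_suml.
by rewrite exchange_big; apply: eq_bigr.
Qed.

Lemma in_span_trans I J (w : I -> T -> R -> R) (w' : J -> T -> R -> R) u :
  (forall i, in_span w' (w i)) -> in_span w u -> in_span w' u.
Proof.
move=> ww' [c uc]; rewrite (_ : u = fun x t => \sum_i c i * w i x t).
  by apply: in_span_sum => i; exact: in_spanZ.
by apply/funext => x; apply/funext => t.
Qed.

Lemma in_spanM I J (w : I -> T -> R -> R) (w' : J -> T -> R -> R) u v :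
  in_span w u -> in_span w' v ->
  in_span (fun (p : I * J) x t => w p.1 x t * w' p.2 x t)
    (fun x t => u x t * v x t).
Proof.
move=> [c uc] [d vd]; exists (fun p => c p.1 * d p.2) => x t.
rewrite uc vd mulr_suml.
rewrite -(pair_bigA _ (fun i j => c i * d j * (w i x t * w' j x t))).
apply: eq_bigr => i _; rewrite mulr_sumr.
by apply: eq_bigr => j _; rewrite mulrACA.
Qed.

End Span.

Section LinearlyGenerated.
Variables (R : realType) (n : nat).
Implicit Types u v : 'rV[R]_n -> R -> R.

Lemma linearly_generated_cst c : linearly_generated (fun (_ : 'rV[R]_n) _ => c).
Proof.
exists unit, (fun _ _ _ => 1); split; last first.
  exists (fun=> c) => x t.
  by rewrite big_const cardT enumT unlock /= addr0 mulr1.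
split=> [_|_]; first exact: polynomial_fun_cst.
exists (fun _ _ => 0) => [|x t]; last exact: is_derive_cst.
by exists (fun=> 0) => x t; rewrite big1// => i _; rewrite mul0r.
Qed.

Lemma linearly_generatedD u v : linearly_generated u -> linearly_generated v ->
  linearly_generated (fun x t => u x t + v x t).
Proof.
move=> [I [w [[w0 dw] wu]]] [J [w' [[w'0 dw'] w'v]]].
pose W (k : I + J) := match k with inl i => w i | inr j => w' j end.
have spanl y : in_span w y -> in_span W y.
  by apply: in_span_trans => i; exact: (in_span_mem W (inl i)).
have spanr y : in_span w' y -> in_span W y.
  by apply: in_span_trans => j; exact: (in_span_mem W (inr j)).
exists (I + J)%type, W; split; last first.
  by apply: in_spanD; [exact: spanl|exact: spanr].
split=> [[i|j]|[i|j]]; [exact: w0|exact: w'0| |].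
  by have [d wd dd] := dw i; exists d => //; exact: spanl.
by have [d wd dd] := dw' j; exists d => //; exact: spanr.
Qed.

(** By the Leibniz rule, the derivative of a product [w i * w' j] is again a combination of such
    products. *)
Lemma linearly_generatedM u v : linearly_generated u -> linearly_generated v ->
  linearly_generated (fun x t => u x t * v x t).
Proof.
move=> [I [w [[w0 dw] wu]]] [J [w' [[w'0 dw'] w'v]]].
exists (I * J)%type, (fun p x t => w p.1 x t * w' p.2 x t).
split; last exact: in_spanM.
split=> [[i j]|[i j]] /=; first exact: polynomial_funM.
have [d wd dd] := dw i; have [d' wd' dd'] := dw' j.
exists (fun x t => d x t * w' j x t + w i x t * d' x t) => [|x t].
  by apply: in_spanD; apply: in_spanM => //; exact: in_span_mem.
exact: is_derive_prod.
Qed.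

(** Each coordinate comes with its own family; their disjoint union is one system that serves all
    coordinates together. *)
Lemma linearly_generated_joint m (u : 'I_m -> 'rV[R]_n -> R -> R) :
  (forall i, linearly_generated (u i)) ->
  exists (I : finType) (w : I -> 'rV[R]_n -> R -> R),
    linear_system w /\ forall i, in_span w (u i).
Proof.
(* The type of the i-th family depends on the chosen [I i], so the families are extracted one by one
   with [cid]. *)
move=> /choice[I sw0]; pose w i := projT1 (cid (sw0 i)).
have sw i : linear_system (w i) /\ in_span (w i) (u i) := projT2 (cid (sw0 i)).
pose W (p : {i : 'I_m & I i}) := w (tag p) (tagged p).
have spanW i y : in_span (w i) y -> in_span W y.
  by apply: in_span_trans => j; exact: (in_span_mem W (Tagged I j)).
exists {i : 'I_m & I i}, W; split; last first.
  by move=> i; apply: (spanW i); have [] := sw i.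
split=> -[i j]; have [[w0 dw] _] := sw i; first exact: w0.
by have [d wd dd] := dw j; exists d => //; exact: (spanW i).
Qed.

End LinearlyGenerated.

Lemma linearly_generated_comp (R : realType) (n m : nat)
    (x : 'rV[R]_n -> R -> 'rV[R]_m) (u : 'rV[R]_m -> R) :
  polynomial_fun u ->
  (forall i, linearly_generated (fun x0 t => x x0 t 0 i)) ->
  linearly_generated (fun x0 t => u (x x0 t)).
Proof.
move=> + gx; elim/polynomial_fun_ind: u / => [c|i|u v|u v].
- exact: linearly_generated_cst.
- exact: gx.
- exact: linearly_generatedD.
- exact: linearly_generatedM.
Qed.

Lemma is_derive_mul_expmx (R : realType) (n : nat) (A : 'M[R]_n) (z : 'rV[R]_n)
    (t : R) i :
  is_derive t 1 (fun s => (z *m expmx (s *: A)) 0 i)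
    ((z *m expmx (t *: A) *m A) 0 i).
Proof.
under eq_fun do rewrite mxE.
rewrite -mulmxA mxE; apply: is_derive_lincomb => j.
exact: (is_derive_expmx A t j i).2.
Qed.

Lemma linearly_generated_expmx (R : realType) (n m : nat) (A : 'M[R]_m)
    (z : 'rV[R]_n -> 'rV[R]_m) i : polynomial_map z ->
  linearly_generated (fun x t => (z x *m expmx (t *: A)) 0 i).
Proof.
move=> pz; pose w j x t := (z x *m expmx (t *: A)) 0 j.
exists 'I_m, w; split; last exact: (in_span_mem w i).
split=> j.
  rewrite /w; under eq_fun do rewrite scale0r expmx0 mulmx1.
  exact: (polynomial_mapP z).1.
exists (fun x t => (z x *m expmx (t *: A) *m A) 0 j) => [|x t].
  exists (A^~ j) => x t; rewrite mxE; apply: eq_bigr => k _.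
  by rewrite mulrC.
exact: is_derive_mul_expmx.
Qed.

(** * Chain rule and one-sided derivatives of trajectories *)

Lemma is_derive_chain (R : realType) (m n : nat) (phi : 'rV[R]_m -> 'rV[R]_n)
    (x : R -> 'rV[R]_m) (v : 'rV[R]_m) (t : R) i : polynomial_map phi ->
  (forall j, is_derive t 1 (fun s => x s 0 j) (v 0 j)) ->
  is_derive t 1 (fun s => phi (x s) 0 i) ((v *m 'J phi (x t)) 0 i).
Proof.
move=> pphi dx.
have xt : derivable x t 1.
  by apply/derivable_mxP => k j; rewrite ord1; have [] := dx j.
have Dx : 'D_1 x t = v.
  by rewrite derive_mx//; apply/rowP => j; rewrite mxE; have [] := dx j.
have xd : differentiable x t by exact/derivable1_diffP.
have pd := polynomial_map_differentiable (x t) pphi.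
have cd : differentiable (phi \o x) t by exact: differentiable_comp.
have cder : derivable (phi \o x) t 1 by exact: diff_derivable.
apply: DeriveDef; first exact: (derivable_mxP (phi \o x) t 1).1.
have <- : 'D_1 (phi \o x) t = v *m 'J phi (x t).
  have dx1 : 'd x t 1 = v by rewrite -deriveE.
  by rewrite deriveE// diff_comp//= dx1 -deriveE// deriveEjacobian.
by rewrite (derive_mx cder) mxE.
Qed.

Lemma is_derive_cvg_within (R : realType) (n : nat) (x : R -> 'rV[R]_n)
    (v : 'rV[R]_n) (t : R) (D : set R) :
  (forall i, is_derive t 1 (fun s => x s 0 i) (v 0 i)) ->
  (fun s => (s - t)^-1 *: (x s - x t)) @ within D t^' --> v.
Proof.
move=> dx; apply: cvg_mx => i j; rewrite ord1.
suff h : (fun s => (s - t)^-1 * (x s 0 j - x t 0 j)) @ t^' --> v 0 j.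
  by under eq_fun do rewrite !mxE; exact: cvg_within_filter.
(* The Carathéodory slope [g] equals the difference quotient away from [t] and is continuous at [t],
   where its value is the derivative. *)
have [g [xg /continuous_withinNx gt gv]] :=
  (is_derive1_caratheodory _ _ _).1 (dx j).
rewrite -gv; apply: cvg_trans gt; apply: near_eq_cvg.
apply: filterS (nbhs_dnbhs_neq t) => s st /=.
by rewrite xg mulrC mulfK// subr_eq0.
Qed.

(** Here [y] has a two-sided derivative at [t] but follows the solution only on nonnegative times.
    Right-hand limits of difference quotients see only those times, even at [t = 0], and uniqueness
    of the limit gives the equality. *)
Lemma is_solution_derive (R : realType) (n : nat) (f : 'rV[R]_n -> 'rV[R]_n)
    (x0 : 'rV[R]_n) (x y : R -> 'rV[R]_n) (v : 'rV[R]_n) (t : R) :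
  is_solution f x0 x -> (forall s, 0 <= s -> y s = x s) -> 0 <= t ->
  (forall i, is_derive t 1 (fun s => y s 0 i) (v 0 i)) -> v = f (y t).
Proof.
move=> [_ xf] yx t0 dy.
have yv := @is_derive_cvg_within _ _ _ _ _ [set s | 0 <= s] dy.
have yf : (fun s => (s - t)^-1 *: (y s - y t)) @ within [set s | 0 <= s] t^'
    --> f (y t).
  rewrite yx//; apply: cvg_trans (xf t t0); apply: near_eq_cvg.
  by rewrite near_withinE; apply: nearW => s s0; rewrite !yx.
have right_within : t^'+ `=>` within [set s | 0 <= s] t^'.
  move=> S St.
  have {}St : \forall s \near t, s != t -> 0 <= s -> S s by exact: St.
  suff : \forall s \near t, t < s -> S s by [].
  apply: filterS St => s Ss ts; apply: Ss; first by rewrite gt_eqF.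
  exact: ltW (le_lt_trans t0 ts).
apply: (@cvg_unique _ (@norm_hausdorff _ 'rV[R]_n)
  ((fun s => (s - t)^-1 *: (y s - y t)) @ t^'+)).
- by apply: cvg_trans yv; exact: cvg_app right_within.
- by apply: cvg_trans yf; exact: cvg_app right_within.
Qed.

(** * Linear lift of the transformed system *)

Lemma super_linearizable_change_of_variables (R : realType) (n : nat)
    (f phi psi : 'rV[R]_n -> 'rV[R]_n) :
  polynomial_map phi -> polynomial_map psi ->
  cancel phi psi -> cancel psi phi ->
  super_linearizable f -> super_linearizable (change_of_variables phi psi f).
Proof.
move=> pphi ppsi phiK psiK [pf [k [p [A [pp sol]]]]].
split.
  apply/polynomial_mapP => j; under eq_fun do rewrite mxE.
  apply: polynomial_fun_sum => i.
  apply: (@polynomial_funM _ _ (fun y => f (psi y) 0 i)).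
    exact: polynomial_fun_comp ((polynomial_mapP f).1 pf i) ppsi.
  exact: (@polynomial_fun_comp _ _ _ psi (fun x => 'J phi x i j)
    (polynomial_fun_jacobian i j pphi) ppsi).
pose z x := row_mx x (p x).
pose X x t := lsubmx (z x *m expmx (t *: A)).
have pz : polynomial_map z.
  apply/polynomial_mapP => i; rewrite /z; case: (split_ordP i) => j ->.
    by under eq_fun do rewrite row_mxEl; exact: polynomial_fun_coord.
  by under eq_fun do rewrite row_mxEr; exact: (polynomial_mapP p).1.
have [I [w [[w0 dw] wY]]] : exists (I : finType) (w : I -> 'rV[R]_n -> R -> R),
    linear_system w /\ forall i, in_span w (fun x t => phi (X x t) 0 i).
  apply: linearly_generated_joint => i.
  apply: (linearly_generated_comp ((polynomial_mapP phi).1 pphi i)) => j.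
  rewrite /X; under eq_fun => x do under eq_fun do rewrite mxE.
  exact: linearly_generated_expmx.
move: wY => /choice[C XC].
have /choice[B wB] j : exists b : I -> R, forall x (t : R),
    is_derive t 1 (w j x) (\sum_l b l * w l x t).
  have [d [b db] dwd] := dw j; exists b => x t.
  by rewrite -db; exact: dwd.
(* Matrices are indexed by ordinals, so [I] is enumerated. Below, [W] and [Y] are parametrized by
   the new initial point [y], through [x0 = psi y]. *)
pose e (j : 'I_#|I|) : I := enum_val j.
have sum_e (F : I -> R) : \sum_j F j = \sum_(j < #|I|) F (e j).
  by rewrite (reindex _ (onW_bij _ (@enum_val_bij I))).
pose W y t : 'rV[R]_#|I| := \row_j w (e j) (psi y) t.
pose Y y t := phi (X (psi y) t).
pose BB := \matrix_(l, j) B (e j) (e l).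
pose CC := \matrix_(j, i) C i (e j).
have YW y t : Y y t = W y t *m CC.
  apply/rowP => i; rewrite /Y XC mxE sum_e; apply: eq_bigr => j _.
  by rewrite !mxE mulrC.
have dW y (t : R) j : is_derive t 1 (fun s => W y s 0 j) ((W y t *m BB) 0 j).
  under eq_fun do rewrite mxE.
  apply: is_derive_eq (wB (e j) (psi y) t) _.
  by rewrite mxE sum_e; apply: eq_bigr => l _; rewrite !mxE mulrC.
have dY y (t : R) i : is_derive t 1 (fun s => Y y s 0 i)
    ((W y t *m (BB *m CC)) 0 i).
  have -> : (fun s => Y y s 0 i) = fun s => \sum_j CC j i * W y s 0 j.
    by apply/funext => s; rewrite YW mxE; apply: eq_bigr => j _; rewrite mulrC.
  apply: is_derive_eq (is_derive_lincomb (CC^~ i) (dW y t)) _.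
  by rewrite mulmxA mxE; apply: eq_bigr => j _; rewrite mulrC.
have Y0 y : Y y 0 = y.
  by rewrite /Y /X scale0r expmx0 mulmx1 row_mxKl psiK.
(* Rows act on the left of the matrix: the zero top blocks say that neither derivative involves [Y],
   and the bottom blocks give [Y' = W BB CC] and [W' = W BB]. *)
exists #|I|, (W^~ 0), (block_mx 0 0 (BB *m CC) BB); split.
  apply/polynomial_mapP => j; under eq_fun do rewrite mxE.
  exact: polynomial_fun_comp (w0 (e j)) ppsi.
move=> y; exists (Y y); split.
  split=> // t t0.
  have [x [solx xX]] := sol (psi y).
  (* [v] is the velocity of the projected linear flow; it equals [f (X (psi y) t)] because this flow
     follows a solution of [f]. The chain rule then turns it into the transformed field at
     [Y y t]. *)
  pose v := lsubmx (z (psi y) *m expmx (t *: A) *m A).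
  have dX i : is_derive t 1 (fun s => X (psi y) s 0 i) (v 0 i).
    rewrite mxE; under eq_fun do rewrite mxE.
    exact: is_derive_mul_expmx.
  rewrite /change_of_variables {2}/Y phiK.
  rewrite -(is_solution_derive solx xX t0 dX).
  by apply: is_derive_cvg_within => i; exact: is_derive_chain.
(* [Z] solves the linear system of the block matrix, so by uniqueness it is the exponential flow
   from [Z 0], whose left part is [Y]. *)
move=> t _; pose Z s := row_mx (Y y s) (W y s).
have -> : row_mx y (W y 0) = Z 0 by rewrite /Z Y0.
have dZ (s : R) i : is_derive s 1 (fun r => Z r 0 i)
    ((Z s *m block_mx 0 0 (BB *m CC) BB) 0 i).
  rewrite /Z mul_row_block !mulmx0 !add0r; case: (split_ordP i) => j ->.
    by under eq_fun do rewrite row_mxEl; rewrite row_mxEl.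
  by under eq_fun do rewrite row_mxEr; rewrite row_mxEr.
by rewrite -(linear_ode_unique dZ) row_mxKl.
Qed.

Theorem theorem2p1 (R : realType) (n : nat) (n_ge1 : (1 <= n)%N)
    (f : 'rV[R]_n -> 'rV[R]_n) (f_sl : super_linearizable f)
    (phi phi_inv : 'rV[R]_n -> 'rV[R]_n) (phi_tame : tame_automorphism phi)
    (phiK : cancel phi phi_inv) (phi_invK : cancel phi_inv phi) :
  super_linearizable (change_of_variables phi phi_inv f).
Proof.
have [pphi [psi ppsi psiK]] := tame_automorphism_polynomial phi_tame.
(* A left inverse and a right inverse of [phi] coincide. *)
have inv_psi : phi_inv = psi.
  by apply/funext => y; rewrite -[in LHS](psiK y) phiK.
by apply: super_linearizable_change_of_variables; rewrite ?inv_psi// -inv_psi.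
Qed.
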